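(* Let $(b_n)_{n\ge1}$, $(c_n)_{n\ge0}$ be real sequences and define, for $n\ge1$, $$p_n=c_{n+4}c_{n+3}^2c_{n+2}^3b_{n+1}\left(c_n^2-b_{n+1}b_n\right),$$ $$\begin{aligned}q_n={}&-b_{n+2}b_{n+1}c_{n+3}^3c_{n+2}^2c_n^2+b_{n+1}^2c_{n+3}c_{n+2}^4b_{n+4}b_n-b_{n+2}b_{n+1}^2b_{n+3}c_{n+3}c_{n+2}^2b_{n+4}b_n\\&+b_{n+2}b_{n+1}b_{n+3}c_{n+3}c_{n+2}^2b_{n+4}c_n^2-b_{n+1}c_{n+3}c_{n+2}^4b_{n+4}c_n^2+b_{n+2}b_{n+1}^2c_{n+3}^3c_{n+2}^2b_n,\end{aligned}$$ $$\begin{aligned}r_n={}&-b_{n+2}b_{n+1}b_{n+3}^2c_{n+2}c_{n+1}b_{n+4}c_n^2-b_{n+1}^2c_{n+2}^3c_{n+1}b_{n+4}b_nb_{n+3}+b_{n+1}b_{n+3}c_{n+2}c_{n+1}^3c_{n+3}^2b_n\\&+b_{n+2}b_{n+1}b_{n+3}c_{n+2}c_{n+1}c_{n+3}^2c_n^2-b_{n+1}c_{n+2}c_{n+1}^3b_{n+4}b_nb_{n+3}^2+b_{n+1}^2c_{n+2}^3c_{n+1}c_{n+3}^2b_n\\&+b_{n+1}b_{n+3}c_{n+2}^3c_{n+1}b_{n+4}c_n^2+b_{n+3}^2c_{n+2}c_{n+1}^3b_{n+4}c_n^2-b_{n+1}c_{n+2}^3c_{n+1}c_{n+3}^2c_n^2\\&-b_{n+2}b_{n+1}^2b_{n+3}c_{n+2}c_{n+1}c_{n+3}^2b_n+b_{n+2}b_{n+1}^2c_{n+2}c_{n+1}b_{n+4}b_nb_{n+3}^2-b_{n+3}c_{n+2}c_{n+1}^3c_{n+3}^2c_n^2,\end{aligned}$$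 $$\begin{aligned}s_n={}&-b_{n+3}c_{n+1}^4c_nc_{n+3}^2b_n+b_{n+2}c_{n+1}^2c_n^3b_{n+4}b_{n+3}^2+b_{n+3}^2c_{n+1}^4c_nb_{n+4}b_n\\&+b_{n+2}b_{n+1}b_{n+3}c_{n+1}^2c_nc_{n+3}^2b_n-b_{n+2}b_{n+1}b_{n+3}^2c_{n+1}^2c_nb_{n+4}b_n-b_{n+2}c_{n+1}^2c_n^3c_{n+3}^2b_{n+3},\end{aligned}$$ $$t_n=b_{n+3}^2b_{n+4}c_{n+1}^3c_n^2c_{n-1}-b_{n+3}c_{n+3}^2c_{n+1}^3c_n^2c_{n-1},$$ and assume $p_n\neq0$ for all $n\ge1$. Let $(A_n)_{n\ge0}$, $(B_n)_{n\ge0}$ be two linearly independent rational-valued solutions of $$c_ny_{n+1}+c_{n-1}y_{n-1}-b_ny_n=0,\qquad n\ge1,$$ with $A_n>0$ and $B_n>0$ for all $n$, such that $\lim_{n\to\infty}B_n/A_n=L$, where $L$ is irrational and not algebraic of degree $2$ over $\mathbb{Q}$. Then $L$ is algebraic of degree three over $\mathbb{Q}$ if and only if the five-term recurrence relation $$p_nz_{n+3}-q_nz_{n+2}-r_nz_{n+1}-s_nz_n-t_nz_{n-1}=0,\qquad n\ge1,$$ has a non-trivial rational-valued solution $(S_n)$ such that $$\frac{S_n}{A_{n+1}A_nA_{n-1}}\to0\quad(n\to\infty).$$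
   Formalization: The solution S_n is read with its index shifted by one: S_n = z_{n-1} for a solution z of the five-term recurrence, i.e. z_{n-1}/(A_{n+1}A_nA_{n-1}) → 0. With S_n = z_n the claim fails, e.g. for A_n = 2^{-n^2} and L transcendental. *)

(* Defs.v *)
From HB Require Import structures.
From mathcomp Require Import all_boot all_order all_algebra.
From mathcomp Require Import all_classical all_reals all_analysis.

Set Implicit Arguments.
Unset Strict Implicit.
Unset Printing Implicit Defensive.

Import Order.TTheory GRing.Theory Num.Theory.
Import numFieldNormedType.Exports.

Local Open Scope classical_set_scope.
Local Open Scope ring_scope.

(* The sequence (b_n)_{n>=1} is a total function [b : nat -> R] whose value at
   0 is never used: [rec3] and [rec5] only range over n >= 1.  For the same
   reason [n.-1] always denotes n - 1 there. *)

Definition pcoef (R : realType) (b c : nat -> R) (n : nat) : R :=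
  c (n + 4)%N * c (n + 3)%N ^+ 2 * c (n + 2)%N ^+ 3 * b (n + 1)%N
    * (c n ^+ 2 - b (n + 1)%N * b n).

Definition qcoef (R : realType) (b c : nat -> R) (n : nat) : R :=
  - (b (n + 2)%N * b (n + 1)%N * c (n + 3)%N ^+ 3 * c (n + 2)%N ^+ 2 * c n ^+ 2)
  + b (n + 1)%N ^+ 2 * c (n + 3)%N * c (n + 2)%N ^+ 4 * b (n + 4)%N * b n
  - b (n + 2)%N * b (n + 1)%N ^+ 2 * b (n + 3)%N * c (n + 3)%N
      * c (n + 2)%N ^+ 2 * b (n + 4)%N * b n
  + b (n + 2)%N * b (n + 1)%N * b (n + 3)%N * c (n + 3)%N
      * c (n + 2)%N ^+ 2 * b (n + 4)%N * c n ^+ 2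
  - b (n + 1)%N * c (n + 3)%N * c (n + 2)%N ^+ 4 * b (n + 4)%N * c n ^+ 2
  + b (n + 2)%N * b (n + 1)%N ^+ 2 * c (n + 3)%N ^+ 3 * c (n + 2)%N ^+ 2 * b n.

Definition rcoef (R : realType) (b c : nat -> R) (n : nat) : R :=
  - (b (n + 2)%N * b (n + 1)%N * b (n + 3)%N ^+ 2 * c (n + 2)%N * c (n + 1)%N
      * b (n + 4)%N * c n ^+ 2)
  - b (n + 1)%N ^+ 2 * c (n + 2)%N ^+ 3 * c (n + 1)%N * b (n + 4)%N * b n
      * b (n + 3)%N
  + b (n + 1)%N * b (n + 3)%N * c (n + 2)%N * c (n + 1)%N ^+ 3
      * c (n + 3)%N ^+ 2 * b n
  + b (n + 2)%N * b (n + 1)%N * b (n + 3)%N * c (n + 2)%N * c (n + 1)%N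
      * c (n + 3)%N ^+ 2 * c n ^+ 2
  - b (n + 1)%N * c (n + 2)%N * c (n + 1)%N ^+ 3 * b (n + 4)%N * b n
      * b (n + 3)%N ^+ 2
  + b (n + 1)%N ^+ 2 * c (n + 2)%N ^+ 3 * c (n + 1)%N * c (n + 3)%N ^+ 2 * b n
  + b (n + 1)%N * b (n + 3)%N * c (n + 2)%N ^+ 3 * c (n + 1)%N * b (n + 4)%N
      * c n ^+ 2
  + b (n + 3)%N ^+ 2 * c (n + 2)%N * c (n + 1)%N ^+ 3 * b (n + 4)%N * c n ^+ 2
  - b (n + 1)%N * c (n + 2)%N ^+ 3 * c (n + 1)%N * c (n + 3)%N ^+ 2 * c n ^+ 2
  - b (n + 2)%N * b (n + 1)%N ^+ 2 * b (n + 3)%N * c (n + 2)%N * c (n + 1)%N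
      * c (n + 3)%N ^+ 2 * b n
  + b (n + 2)%N * b (n + 1)%N ^+ 2 * c (n + 2)%N * c (n + 1)%N * b (n + 4)%N
      * b n * b (n + 3)%N ^+ 2
  - b (n + 3)%N * c (n + 2)%N * c (n + 1)%N ^+ 3 * c (n + 3)%N ^+ 2 * c n ^+ 2.

Definition scoef (R : realType) (b c : nat -> R) (n : nat) : R :=
  - (b (n + 3)%N * c (n + 1)%N ^+ 4 * c n * c (n + 3)%N ^+ 2 * b n)
  + b (n + 2)%N * c (n + 1)%N ^+ 2 * c n ^+ 3 * b (n + 4)%N * b (n + 3)%N ^+ 2
  + b (n + 3)%N ^+ 2 * c (n + 1)%N ^+ 4 * c n * b (n + 4)%N * b n
  + b (n + 2)%N * b (n + 1)%N * b (n + 3)%N * c (n + 1)%N ^+ 2 * c n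
      * c (n + 3)%N ^+ 2 * b n
  - b (n + 2)%N * b (n + 1)%N * b (n + 3)%N ^+ 2 * c (n + 1)%N ^+ 2 * c n
      * b (n + 4)%N * b n
  - b (n + 2)%N * c (n + 1)%N ^+ 2 * c n ^+ 3 * c (n + 3)%N ^+ 2 * b (n + 3)%N.

Definition tcoef (R : realType) (b c : nat -> R) (n : nat) : R :=
  b (n + 3)%N ^+ 2 * b (n + 4)%N * c (n + 1)%N ^+ 3 * c n ^+ 2 * c n.-1
  - b (n + 3)%N * c (n + 3)%N ^+ 2 * c (n + 1)%N ^+ 3 * c n ^+ 2 * c n.-1.

Definition rec3 (R : realType) (b c y : nat -> R) : Prop :=
  forall n : nat, (1 <= n)%N ->
    c n * y n.+1 + c n.-1 * y n.-1 - b n * y n = 0.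

(* If [y] satisfies [rec3 b c] then z_n = y_{n+2} y_{n+1} y_n satisfies
   [rec5 b c]; this is where the coefficients come from. *)
Definition rec5 (R : realType) (b c z : nat -> R) : Prop :=
  forall n : nat, (1 <= n)%N ->
    pcoef b c n * z (n + 3)%N - qcoef b c n * z (n + 2)%N
      - rcoef b c n * z (n + 1)%N - scoef b c n * z n - tcoef b c n * z n.-1
    = 0.

Definition rational_valued (R : realType) (u : nat -> R) : Prop :=
  forall n : nat, rational (u n).

Definition lin_indep (R : realType) (u v : nat -> R) : Prop :=
  forall x y : R, (forall n : nat, x * u n + y * v n = 0) -> x = 0 /\ y = 0.

(* [x] has a minimal polynomial over the rationals, of degree [d]. *)
Definition algebraic_of_degree (R : realType) (d : nat) (x : R) : Prop :=
  exists p : {poly rat},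
    [/\ p \is monic, irreducible_poly p, size p = d.+1
      & root (map_poly ratr p) x].

(* Main.v *)
(* A polynomial p of degree at most 3 is polarised into a symmetric trilinear
   form T_p on pairs.  With v_n = (A_n, B_n), every sequence
   z_n = T_p (v_{n+2}, v_{n+1}, v_n) solves the five-term recurrence, and
   z_{n-1} / (A_{n+1} A_n A_{n-1}) tends to p(L).  The space of solutions is
   4-dimensional since p_n <> 0, and the map p |-> z is injective already on
   z_0, ..., z_3: if T_p vanishes on four consecutive triples, then the
   three-term recurrence together with c_n^2 <> b_{n+1} b_n and b_{n+1} <> 0
   forces T_p = 0.  As A and B are rational, the rational solutions are exactly
   those coming from a rational p, so a rational solution with the required
   decay amounts to a nonzero rational polynomial of degree at most 3 with
   root L. *)

Require Import Defs.
From mathcomp Require Import all_boot all_order all_algebra ring lra zify.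
From mathcomp Require Import all_classical all_reals all_analysis.

Set Implicit Arguments.
Unset Strict Implicit.
Unset Printing Implicit Defensive.

Import Order.TTheory GRing.Theory Num.Theory.
Import numFieldNormedType.Exports.

Local Open Scope classical_set_scope.
Local Open Scope ring_scope.

(** * Solutions of the five-term recurrence built from the three-term one *)

Lemma rec3_step (R : realType) (b c y : nat -> R) (n : nat) : rec3 b c y ->
  c n.+1 * y n.+2 = b n.+1 * y n.+1 - c n * y n.
Proof.
by move=> /(_ n.+1 isT) /eqP; rewrite subr_eq0 => /eqP/= <-; rewrite addrK.
Qed.

Lemma rec3_comb (R : realType) (b c y y' : nat -> R) (s : R) :
  rec3 b c y -> rec3 b c y' -> rec3 b c (fun n => s * y n + y' n).
Proof.
move=> hy hy' n n1; have := congr1 ( *%R s) (hy n n1); have := hy' n n1.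
by rewrite mulr0; lra.
Qed.

Lemma rec5_comb (R : realType) (b c z z' : nat -> R) (s : R) :
  rec5 b c z -> rec5 b c z' -> rec5 b c (fun n => s * z n + z' n).
Proof.
move=> hz hz' n n1; have := congr1 ( *%R s) (hz n n1); have := hz' n n1.
by rewrite mulr0; lra.
Qed.

Lemma rec5_prod (R : realType) (b c y : nat -> R) : rec3 b c y ->
  rec5 b c (fun n => y n.+2 * y n.+1 * y n).
Proof.
move=> hy [//|n] _; rewrite /pcoef /qcoef /rcoef /scoef /tcoef.
have h i := rec3_step (i + n) hy.
have := (h 0, h 1, h 2, h 3, h 4).
rewrite !addnS !addn0 !add0n !addSn !add0n /= => -[[[[h0 h1] h2] h3] h4].
move: (b n.+1) (b n.+2) (b n.+3) (b n.+4) (b n.+4.+1) h0 h1 h2 h3 h4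
  => b0 b1 b2 b3 b4.
move: (c n) (c n.+1) (c n.+2) (c n.+3) (c n.+4) (c n.+4.+1)
  => cm c0 c1 c2 c3 c4.
move: (y n) (y n.+1) (y n.+2) (y n.+3) (y n.+4) (y n.+4.+1) (y n.+4.+2)
  => ym y0 y1 y2 y3 y4 y5 h0 h1 h2 h3 h4.
(* Everything is expressed through y1 and y2: the powers of the c's in the
   coefficients are exactly those needed for that. *)
have k0 : c0 * y0 = b1 * y1 - c1 * y2 by rewrite h1 subKr.
have km : c0 * (cm * ym) = b0 * (b1 * y1 - c1 * y2) - c0 ^+ 2 * y1.
  by rewrite -k0 -[cm * ym](subKr (b0 * y0)) -h0; ring.
have k4 : c2 * (c3 * y4) = b3 * (b2 * y2 - c1 * y1) - c2 ^+ 2 * y2.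
  by rewrite h3 -h2; ring.
have k5 : c2 * c3 * (c4 * y5) = b4 * (b3 * (b2 * y2 - c1 * y1) - c2 ^+ 2 * y2)
    - c3 ^+ 2 * (b2 * y2 - c1 * y1).
  by rewrite h4 -k4 -h2; ring.
transitivity (b1 * (c0 ^+ 2 - b1 * b0) * (c2 * y3) * (c2 * (c3 * y4))
    * (c2 * c3 * (c4 * y5))
  - (- (b2 * b1 * c3 ^+ 2 * c0 ^+ 2) + b1 ^+ 2 * c2 ^+ 2 * b4 * b0
     - b2 * b1 ^+ 2 * b3 * b4 * b0 + b2 * b1 * b3 * b4 * c0 ^+ 2
     - b1 * c2 ^+ 2 * b4 * c0 ^+ 2 + b2 * b1 ^+ 2 * c3 ^+ 2 * b0)
    * ((c2 * (c3 * y4)) * (c2 * y3) * y2)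
  - (- (b2 * b1 * b3 ^+ 2 * c1 * b4 * c0 ^+ 2)
     - b1 ^+ 2 * c2 ^+ 2 * c1 * b4 * b0 * b3
     + b1 * b3 * c1 ^+ 3 * c3 ^+ 2 * b0
     + b2 * b1 * b3 * c1 * c3 ^+ 2 * c0 ^+ 2
     - b1 * c1 ^+ 3 * b4 * b0 * b3 ^+ 2
     + b1 ^+ 2 * c2 ^+ 2 * c1 * c3 ^+ 2 * b0
     + b1 * b3 * c2 ^+ 2 * c1 * b4 * c0 ^+ 2
     + b3 ^+ 2 * c1 ^+ 3 * b4 * c0 ^+ 2
     - b1 * c2 ^+ 2 * c1 * c3 ^+ 2 * c0 ^+ 2
     - b2 * b1 ^+ 2 * b3 * c1 * c3 ^+ 2 * b0
     + b2 * b1 ^+ 2 * c1 * b4 * b0 * b3 ^+ 2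
     - b3 * c1 ^+ 3 * c3 ^+ 2 * c0 ^+ 2)
    * ((c2 * y3) * y2 * y1)
  - (- (b3 * c1 ^+ 4 * c3 ^+ 2 * b0) + b2 * c1 ^+ 2 * c0 ^+ 2 * b4 * b3 ^+ 2
     + b3 ^+ 2 * c1 ^+ 4 * b4 * b0 + b2 * b1 * b3 * c1 ^+ 2 * c3 ^+ 2 * b0
     - b2 * b1 * b3 ^+ 2 * c1 ^+ 2 * b4 * b0
     - b2 * c1 ^+ 2 * c0 ^+ 2 * c3 ^+ 2 * b3)
    * (y2 * y1 * (c0 * y0))
  - (b3 ^+ 2 * b4 - b3 * c3 ^+ 2) * c1 ^+ 3
    * (y1 * (c0 * y0) * (c0 * (cm * ym)))).
  by ring.
by rewrite k5 k4 km k0 h2; ring.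
Qed.

(* The symmetric trilinear form T with T (1, x) (1, x) (1, x) = p.[x], for p
   of degree at most 3. *)
Definition polar (F : fieldType) (p : {poly F}) (u v w : F * F) : F :=
  p`_0 * (u.1 * v.1 * w.1)
  + p`_1 / 3%:R * (u.2 * v.1 * w.1 + u.1 * v.2 * w.1 + u.1 * v.1 * w.2)
  + p`_2 / 3%:R * (u.2 * v.2 * w.1 + u.2 * v.1 * w.2 + u.1 * v.2 * w.2)
  + p`_3 * (u.2 * v.2 * w.2).

Lemma rec5_polar (R : realType) (b c A B : nat -> R) (p : {poly R}) :
  rec3 b c A -> rec3 b c B ->
  let v n := (A n, B n) in rec5 b c (fun n => polar p (v n.+2) (v n.+1) (v n)).
Proof.
move=> hA hB v.
(* Products of three consecutive terms of A, B, A + B and A - B span all the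
   polarised forms. *)
have hD := rec3_comb 1 hA hB.
have hS := rec3_comb (-1) hB hA.
(* Comparing the mixed terms of [s (A + B)^3 + d (A - B)^3] with [p] gives [3 (s - d) = p_1] and
   [3 (s + d) = p_2]; multiples of [A^3] and [B^3] correct the pure terms. *)
pose s := (p`_2 + p`_1) / 6%:R; pose d := (p`_2 - p`_1) / 6%:R.
have zA := rec5_prod hA; have zB := rec5_prod hB.
have zD := rec5_prod hD; have zS := rec5_prod hS.
(* The [- 1] offsets the innermost [zA], which enters with coefficient 1. *)
have := rec5_comb s zD (rec5_comb d zS
  (rec5_comb (p`_3 - s + d) zB
    (rec5_comb (p`_0 - s - d - 1) zA zA))).
congr rec5; apply/funext => n; rewrite /polar /v /s /d /=.
by field.
Qed.

Lemma rec5_eq (R : realType) (b c z z' : nat -> R) :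
  (forall n : nat, (1 <= n)%N -> pcoef b c n <> 0) ->
  rec5 b c z -> rec5 b c z' ->
  (forall n, (n < 4)%N -> z n = z' n) -> z =1 z'.
Proof.
move=> hp hz hz' h4; elim/ltn_ind => n IH.
have [/h4//|n4] := ltnP n 4; rewrite -(subnK n4) addnS in IH *.
move: (n - 4)%N => m in IH *.
have := hz' m.+1 isT; rewrite -(hz m.+1 isT).
rewrite !addSn !addnS !addn0 /= !(IH m, IH m.+1, IH m.+2, IH m.+3); try lia.
move=> e.
by apply: (mulfI (introN eqP (hp m.+1 isT))); lra.
Qed.

(** * Injectivity of polarisation on four consecutive triples *)

Section Nondegeneracy.
Context (R : realType) (b c A B : nat -> R).
Hypothesis hp : forall n : nat, (1 <= n)%N -> pcoef b c n <> 0.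
Hypotheses (hA : rec3 b c A) (hB : rec3 b c B).
Let v n := (A n, B n).

Lemma pcoef_neq0 n : [/\ c n.+3 != 0, b n.+2 != 0 &
  c n.+1 ^+ 2 - b n.+2 * b n.+1 != 0].
Proof.
by split; apply/eqP => e0; apply: (@hp n.+1 isT);
  rewrite /pcoef !addnS !addn0 e0 ?expr0n /= ?(mulr0, mul0r).
Qed.

(** Being linear in its last argument, the form inherits the three-term recurrence there. *)
Lemma polar_step (p : {poly R}) u w n :
  c n.+1 * polar p u w (v n.+2)
  = b n.+1 * polar p u w (v n.+1) - c n * polar p u w (v n).
Proof.
have := (rec3_step n hA, rec3_step n hB) => -[eA eB].
transitivity (p`_0 * (u.1 * w.1 * (c n.+1 * A n.+2))
  + p`_1 / 3%:R * (u.2 * w.1 * (c n.+1 * A n.+2) + u.1 * w.2 * (c n.+1 * A n.+2)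
     + u.1 * w.1 * (c n.+1 * B n.+2))
  + p`_2 / 3%:R * (u.2 * w.2 * (c n.+1 * A n.+2) + u.2 * w.1 * (c n.+1 * B n.+2)
     + u.1 * w.2 * (c n.+1 * B n.+2))
  + p`_3 * (u.2 * w.2 * (c n.+1 * B n.+2))); rewrite /polar /=; first by ring.
by rewrite eA eB; ring.
Qed.

Lemma polarCA p (u w x : R * R) : polar p u w x = polar p w u x.
Proof. by rewrite /polar; ring. Qed.

Lemma polarAC p (u w x : R * R) : polar p u w x = polar p u x w.
Proof. by rewrite /polar; ring. Qed.

(** The two hypotheses remove the outer terms of two recurrence steps, leaving a homogeneous 2 by 2
    system in the mixed values [x] and [y]: [c_{m+1} y = b_{m+1} x] and [b_{m+2} y = c_{m+1} x]. Its
    determinant is, up to sign, the factor [c_{m+1}^2 - b_{m+2} b_{m+1}] of [pcoef]. *)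
Lemma polar_pair_eq0 (p : {poly R}) m :
  polar p (v m.+2) (v m.+1) (v m) = 0 ->
  polar p (v m.+3) (v m.+2) (v m.+1) = 0 ->
  polar p (v m.+1) (v m.+1) (v m.+2) = 0 /\
  polar p (v m.+1) (v m.+2) (v m.+2) = 0.
Proof.
move=> t0 t1; have [_ b0 D0] := pcoef_neq0 m.
have := polar_step p (v m.+1) (v m.+2) m.
have := polar_step p (v m.+1) (v m.+2) m.+1.
rewrite [polar p (v m.+1) (v m.+2) (v m)]polarCA t0.
have -> : polar p (v m.+1) (v m.+2) (v m.+3) = 0.
  by rewrite -t1 /polar; ring.
rewrite [polar p (v m.+1) (v m.+2) (v m.+1)]polarAC !mulr0 subr0.
set x := polar p (v m.+1) (v m.+1) (v m.+2).
set y := polar p (v m.+1) (v m.+2) (v m.+2).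
move=> /esym/eqP; rewrite subr_eq0 => /eqP e1 e2.
have x0 : x = 0.
  apply: (mulfI D0); rewrite mulr0.
  transitivity (c m.+1 * (c m.+1 * x) - b m.+2 * (b m.+1 * x)); first by ring.
  by rewrite -e1 -e2; ring.
by split=> //; apply: (mulfI b0); rewrite e1 x0 !mulr0.
Qed.

(** Mixed values at neighbouring vectors vanish, and one more recurrence step gives the pure values
    at [v 2] and [v 3]. These two vectors form a basis, so the whole form vanishes. *)
Lemma polar_eq0 (p : {poly R}) : A 3 * B 2 != A 2 * B 3 -> (size p <= 4)%N ->
  (forall n, (n < 4)%N -> polar p (v n.+2) (v n.+1) (v n) = 0) -> p = 0.
Proof.
move=> W sp t.
have [_ a0] := polar_pair_eq0 (t 0 isT) (t 1 isT).
have [x1 y1] := polar_pair_eq0 (t 1 isT) (t 2 isT).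
have [x2 _] := polar_pair_eq0 (t 2 isT) (t 3 isT).
have [_ b2 _] := pcoef_neq0 0; have [_ b3 _] := pcoef_neq0 1.
have t2 : polar p (v 2) (v 2) (v 2) = 0.
  apply: (mulfI b2); have := polar_step p (v 2) (v 2) 1.
  have -> : polar p (v 2) (v 2) (v 1) = 0 by rewrite -a0 /polar; ring.
  by rewrite x1; lra.
have t3 : polar p (v 3) (v 3) (v 3) = 0.
  apply: (mulfI b3); have := polar_step p (v 3) (v 3) 2.
  have -> : polar p (v 3) (v 3) (v 2) = 0 by rewrite -y1 /polar; ring.
  by rewrite x2; lra.
(* By Cramer's rule (A 3 * B 2 - A 2 * B 3) times the standard basis is a
   combination of v 2 and v 3; the cube comes from trilinearity. *)
have W3 : (A 3 * B 2 - A 2 * B 3) ^+ 3 != 0 by rewrite expf_neq0 ?subr_eq0.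
have E w2 w3 y2 y3 z2 z3 r : (A 3 * B 2 - A 2 * B 3) ^+ 3 * r =
    w2 * y2 * z2 * polar p (v 2) (v 2) (v 2)
    + (w2 * y2 * z3 + w2 * y3 * z2 + w3 * y2 * z2)
      * polar p (v 2) (v 2) (v 3)
    + (w2 * y3 * z3 + w3 * y2 * z3 + w3 * y3 * z2)
      * polar p (v 2) (v 3) (v 3)
    + w3 * y3 * z3 * polar p (v 3) (v 3) (v 3) -> r = 0.
  by rewrite t2 x1 y1 t3 !mulr0 !addr0 => e; apply: (mulfI W3); rewrite mulr0.
have c0 : p`_0 = 0.
  apply: (E (- B 3) (B 2) (- B 3) (B 2) (- B 3) (B 2)).
  by rewrite /polar /=; field.
(* Tripling the third vector cancels the division by 3 in [polar]. *)
have c1 : p`_1 = 0.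
  apply: (E (- B 3) (B 2) (- B 3) (B 2) (3%:R * A 3) (- (3%:R * A 2))).
  by rewrite /polar /=; field.
have c2 : p`_2 = 0.
  apply: (E (- B 3) (B 2) (A 3) (- A 2) (3%:R * A 3) (- (3%:R * A 2))).
  by rewrite /polar /=; field.
have c3 : p`_3 = 0.
  apply: (E (A 3) (- A 2) (A 3) (- A 2) (A 3) (- A 2)).
  by rewrite /polar /=; field.
apply/polyP => i; rewrite coef0; case: i => [|[|[|[|i]]]] //.
by rewrite nth_default// (leq_trans sp).
Qed.
End Nondegeneracy.

(** A zero Casoratian would propagate upwards, making [B n / A n] constant from index 2 on; its
    limit [L] would then be rational. *)
Lemma casoratian_neq0 (R : realType) (b c A B : nat -> R) (L : R) :
  (forall n : nat, (1 <= n)%N -> pcoef b c n <> 0) ->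
  rec3 b c A -> rec3 b c B -> rational_valued A -> rational_valued B ->
  (forall n, 0 < A n) -> (fun n => B n / A n) @ \oo --> L -> irrational L ->
  A 3 * B 2 != A 2 * B 3.
Proof.
move=> hp hA hB hAQ hBQ A0 hL hirr; apply/eqP => W0; apply: hirr.
have W n : A n.+3 * B n.+2 = A n.+2 * B n.+3.
  elim: n => // n IH; have [c0 _ _] := pcoef_neq0 hp n.
  apply: (mulfI c0); have eA := rec3_step n.+2 hA.
  have eB := rec3_step n.+2 hB.
  rewrite mulrA eA [A n.+3 * _]mulrC mulrA eB.
  have := congr1 ( *%R (c n.+2)) IH; lra.
have r n : B n.+2 / A n.+2 = B 2 / A 2.
  elim: n => // n <-; have := W n; have := A0 n.+2; have := A0 n.+3.
  move=> /lt0r_neq0 ? /lt0r_neq0 ? e; apply/eqP.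
  by rewrite eqr_div//; apply/eqP; lra.
have : (fun n : nat => B 2 / A 2) @ \oo --> L.
  rewrite -cvg_shiftS -cvg_shiftS /= in hL.
  by have -> : (fun=> B 2 / A 2) = (fun n => B n.+2 / A n.+2) by apply/funext.
move/(cvg_unique _ (cvg_cst _)) => <- //.
have [[x _ <-] [y _ <-]] := (hAQ 2, hBQ 2).
by exists (y / x) => //; rewrite rmorphM fmorphV.
Qed.

(** * Algebraic degree of a root of a rational polynomial *)

(** Induction on the size: an irreducible [p] is made monic, and otherwise one of two smaller
    factors has the root [L]. *)
Lemma algebraic_of_degree_root (R : realType) (p : {poly rat}) (L : R) :
  p != 0 -> root (map_poly ratr p) L ->
  exists2 d, (0 < d < size p)%N & algebraic_of_degree d L.
Proof.
have [m] := ubnP (size p); elim: m p => // m IH p sp p0 rp.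
have s1 : (1 < size p)%N.
  rewrite ltnNge; apply: contraL rp => /size1_polyC pE.
  by rewrite pE map_polyC rootC fmorph_eq0 -polyC_eq0 -pE.
have [irr|/existsNP[q /not_implyP[sq /not_implyP[qp /negP neq]]]] :=
    pselect (forall q : {poly rat}, size q != 1%N -> q %| p -> q %= p).
  exists (size p).-1; first by lia.
  exists ((lead_coef p)^-1 *: p); have l0 : (lead_coef p)^-1 != 0.
    by rewrite invr_eq0 lead_coef_eq0.
  split.
  - by rewrite monicE lead_coefZ mulVf // lead_coef_eq0.
  - split; first by rewrite size_scale.
    move=> q sq; rewrite dvdpZr// => /(irr q sq) /eqp_trans; apply.
    by rewrite eqp_sym eqp_scale.
  - by rewrite size_scale// prednK// ltnW.
  - by rewrite map_polyZ rootZ// fmorph_eq0.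
have /dvdpP[r pE] := qp.
have q0 : q != 0 by apply: contraNneq p0 => q0; rewrite pE q0 mulr0.
have r0 : r != 0 by apply: contraNneq p0 => r0; rewrite pE r0 mul0r.
have qlt : (size q < size p)%N.
  by rewrite ltn_neqAle dvdp_leq// dvdp_size_eqp// neq.
have rlt : (size r < size p)%N.
  have q2 : (1 < size q)%N.
    by rewrite ltn_neqAle eq_sym sq size_poly_gt0.
  by rewrite pE size_mul// -(subnK q2) addnA addn2 ltnS leq_addr.
have wide (s : {poly rat}) : (size s < size p)%N -> s != 0 ->
    root (map_poly ratr s) L ->
    exists2 d, (0 < d < size p)%N & algebraic_of_degree d L.
  move=> slt s0 rs; have [d /andP[d0 ds] hd] := IH s (leq_trans slt sp) s0 rs.
  by exists d => //; rewrite d0 (ltn_trans ds).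
have : root (map_poly ratr (r * q)) L by rewrite -pE.
by rewrite rmorphM rootM => /orP[]; exact: wide.
Qed.

Lemma algebraic_of_degree1 (R : realType) (L : R) :
  algebraic_of_degree 1 L -> rational L.
Proof.
move=> [p [/monicP pm _ sp]]; rewrite rootE horner_coef size_map_poly sp.
rewrite !big_ord_recl big_ord0 !coef_map /= mulr1 addr0.
move: pm; rewrite lead_coefE sp /bump /= => ->.
rewrite rmorph1 mul1r expr1 addrC addr_eq0 => /eqP ->.
by exists (- p`_0) => //; rewrite rmorphN.
Qed.

(** * Interpolation and limits of polarised forms *)

Lemma polar_coef (F : fieldType) (p : {poly F}) u v w : (size p <= 4)%N ->
  polar p u v w = \sum_(i < 4) p`_i * polar 'X^i u v w.
Proof.
by move=> sp; rewrite !big_ord_recl big_ord0 /polar !coefXn /=; ring.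
Qed.

Lemma map_polar (F F' : fieldType) (f : {rmorphism F -> F'}) (p : {poly F})
    u v w :
  f (polar p u v w) = polar (map_poly f p) (f u.1, f u.2) (f v.1, f v.2)
    (f w.1, f w.2).
Proof.
by rewrite /polar !coef_map /= !(rmorphD, rmorphM, fmorphV, rmorph1).
Qed.

(** Injectivity of a square linear system gives surjectivity. The field is arbitrary so that
    rational data yield a rational [p]. *)
Lemma polar_interpolation (F : fieldType) (v : nat -> F * F) (z : nat -> F) :
  (forall p : {poly F}, (size p <= 4)%N ->
    (forall n, (n < 4)%N -> polar p (v n.+2) (v n.+1) (v n) = 0) -> p = 0) ->
  exists2 p : {poly F}, (size p <= 4)%N &
    forall n, (n < 4)%N -> polar p (v n.+2) (v n.+1) (v n) = z n.
Proof.
move=> nondeg.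
pose M := \matrix_(i < 4, j < 4) polar 'X^i (v j.+2) (v j.+1) (v j).
have rM (x : 'rV_4) (j : 'I_4) :
    polar (rVpoly x) (v j.+2) (v j.+1) (v j) = (x *m M) 0 j.
  rewrite polar_coef ?size_poly// mxE; apply: eq_bigr => i _.
  by rewrite mxE coef_rVpoly_ord.
have uM : M \in unitmx.
  rewrite -row_free_unit; apply: inj_row_free => x xM.
  apply: (can_inj rVpolyK); rewrite linear0; apply: nondeg.
    exact: size_poly.
  by move=> n n4; rewrite (rM x (Ordinal n4)) xM mxE.
exists (rVpoly ((\row_j z j) *m invmx M)); first exact: size_poly.
by move=> n n4; rewrite (rM _ (Ordinal n4)) mulmxKV// mxE.
Qed.

Lemma cvg_polar1 (R : realType) (p : {poly R}) (f g h : nat -> R) (x y t : R) :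
  f @ \oo --> x -> g @ \oo --> y -> h @ \oo --> t ->
  (fun n => polar p (1, f n) (1, g n) (1, h n)) @ \oo
    --> polar p (1, x) (1, y) (1, t).
Proof.
move=> hf hg hh.
have one : (fun _ : nat => 1 : R) @ \oo --> (1 : R) by exact: cvg_cst.
rewrite /polar /=.
apply: cvgD; [apply: cvgD; [apply: cvgD|]|]; apply: cvgM; try exact: cvg_cst.
- exact: cvgD (cvgD (cvgM (cvgM hf one) one) (cvgM (cvgM one hg) one))
    (cvgM (cvgM one one) hh).
- exact: cvgD (cvgD (cvgM (cvgM hf hg) one) (cvgM (cvgM hf one) hh))
    (cvgM (cvgM one hg) hh).
- exact: cvgM (cvgM hf hg) hh.
Qed.

(** By trilinearity the division rescales each [v n] to [(1, B n / A n)], which tends to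
    [(1, L)]. *)
Lemma cvg_polar (R : realType) (A B : nat -> R) (L : R) (p : {poly R}) :
  (forall n, 0 < A n) -> (fun n => B n / A n) @ \oo --> L -> (size p <= 4)%N ->
  let v n := (A n, B n) in
  (fun n => polar p (v n.+2) (v n.+1) (v n) / (A n.+2 * A n.+1 * A n)) @ \oo
    --> p.[L].
Proof.
move=> A0 hL sp v.
pose r n := B n / A n.
have -> : (fun n => polar p (v n.+2) (v n.+1) (v n) / (A n.+2 * A n.+1 * A n))
    = (fun n => polar p (1, r n.+2) (1, r n.+1) (1, r n)).
  apply/funext => n; rewrite /polar /r /=; field.
  by rewrite !lt0r_neq0.
have -> : p.[L] = polar p (1, L) (1, L) (1, L).
  by rewrite (horner_coef_wide _ sp) !big_ord_recl big_ord0 /polar /=; field.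
have r1 : (fun n => r n.+1) @ \oo --> L by rewrite cvg_shiftS.
have r2 : (fun n => r n.+2) @ \oo --> L.
  by rewrite (cvg_shiftS (fun n => r n.+1)).
exact: cvg_polar1.
Qed.

(* Since z_n = y_{n+2} y_{n+1} y_n solves [rec5] whenever y solves [rec3], the
   term z_{n-1} is the one to be compared with A_{n+1} A_n A_{n-1}: the
   solution (S_n) is enumerated from n = 1, i.e. S_n = z_{n-1}.  With
   S_n = z_n the equivalence fails (take A_n = 2^(-n^2), L transcendental). *)
Theorem theorem4p1 (R : realType) (b c A B : nat -> R) (L : R)
    (hp : forall n : nat, (1 <= n)%N -> pcoef b c n <> 0)
    (hA : rec3 b c A) (hB : rec3 b c B)
    (hAB : lin_indep A B)
    (hAQ : rational_valued A) (hBQ : rational_valued B)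
    (hA0 : forall n : nat, 0 < A n) (hB0 : forall n : nat, 0 < B n)
    (hL : (fun n : nat => B n / A n) @ \oo --> L)
    (hirr : irrational L)
    (hquad : ~ algebraic_of_degree 2 L) :
  algebraic_of_degree 3 L <->
  exists z : nat -> R,
    [/\ rec5 b c z,
        exists n : nat, z n <> 0,
        rational_valued z
      & (fun n : nat => z n.-1 / (A n.+1 * A n * A n.-1)) @ \oo --> (0 : R)].
Proof.
have W := casoratian_neq0 hp hA hB hAQ hBQ hA0 hL hirr.
have nondeg := polar_eq0 hp hA hB W.
pose v n := (A n, B n).
pose form (p : {poly rat}) n :=
  polar (map_poly ratr p) (v n.+2) (v n.+1) (v n).
have /choice[A' hA'] : forall n, exists q : rat, ratr q = A n.
  by move=> n; have [q _ <-] := hAQ n; exists q.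
have /choice[B' hB'] : forall n, exists q : rat, ratr q = B n.
  by move=> n; have [q _ <-] := hBQ n; exists q.
pose v' n := (A' n, B' n).
have formE p n : form p n = ratr (polar p (v' n.+2) (v' n.+1) (v' n)).
  by rewrite map_polar /= !hA' !hB'.
have form0 (p : {poly rat}) : (size p <= 4)%N ->
    (forall n, (n < 4)%N -> form p n = 0) -> p = 0.
  move=> sp h; have : map_poly (ratr : rat -> R) p = 0.
    by apply: nondeg h; rewrite size_map_poly.
  by move/eqP; rewrite map_poly_eq0 => /eqP.
have lim (p : {poly rat}) : (size p <= 4)%N ->
    (fun n => form p n.-1 / (A n.+1 * A n * A n.-1)) @ \oo
      --> (map_poly ratr p).[L].
  (* The shift drops index 0, where [n.-1] is truncated. *)
  move=> sp; rewrite -cvg_shiftS.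
  by apply: cvg_polar; rewrite ?size_map_poly.
split=> [[p [/monicP pm _ sp rp]]|[z [hz [m zm] zQ z0]]].
  exists (form p); split; first exact: rec5_polar.
  - apply/existsNP => f0; suff p0 : p = 0 by rewrite p0 size_poly0 in sp.
    by apply: form0 => [|n _]; [rewrite sp | exact: f0].
  - by move=> n; rewrite formE; eexists.
  - by move/eqP: rp => <-; apply: lim; rewrite sp.
have /choice[z' hz'] : forall n, exists q : rat, ratr q = z n.
  by move=> n; have [q _ <-] := zQ n; exists q.
have [p sp hpz] : exists2 p : {poly rat}, (size p <= 4)%N &
    forall n, (n < 4)%N -> polar p (v' n.+2) (v' n.+1) (v' n) = z' n.
  apply: polar_interpolation => p sp h; apply: form0 => // n n4.
  by rewrite formE h// rmorph0.
have zE : z =1 form p.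
  apply: rec5_eq hp hz _ _; first exact: rec5_polar.
  by move=> n n4; rewrite formE hpz.
have p0 : p != 0.
  apply/eqP => p0; apply: zm.
  by rewrite zE formE p0 /polar !coef0 !mul0r !addr0 rmorph0.
have rp : root (map_poly ratr p) L.
  rewrite (funext zE) in z0.
  by apply/eqP; apply: cvg_unique (lim _ sp) z0.
(* The degree is 1, 2 or 3; irrationality excludes 1 and [hquad] excludes 2. *)
have [[|[|[|[|d]]]] // /andP[_ dp] hd] := algebraic_of_degree_root p0 rp.
- by case: hirr; exact: algebraic_of_degree1.
- by case: (leq_trans dp sp).
Qed.
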